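(* Let $U:\mathbb{R}^d\to\mathbb{R}$ be the potential energy, let $H(q,p)=U(q)+\tfrac12 p^Tp$ for $(q,p)\in\mathbb{R}^d\times\mathbb{R}^d$, and let $\widehat{\nabla U}:\mathbb{R}^d\to\mathbb{R}^d$ be an approximate gradient field (no accuracy of the approximation to $\nabla U$ is assumed). Let $\epsilon>0$ be a step size and $L\ge 1$ a number of leapfrog steps. Then the neural network gradient Hamiltonian Monte Carlo (NNgHMC) transition kernel on $\mathbb{R}^d\times\mathbb{R}^d$ with these parameters leaves invariant the canonical distribution, i.e. the probability distribution on $\mathbb{R}^d\times\mathbb{R}^d$ with density proportional to $\exp\{-H(q,p)\}$ with respect to Lebesgue measure.
   Context: Standing conventions: $U(q)=-\log\big(\pi(x|q)\pi(q)\big)$ is the negative log of an unnormalized posterior density on $\mathbb{R}^d$; so $U$ is measurable and $\int_{\mathbb{R}^d} e^{-U(q)}\,dq$ is finite and positive. $\widehat{\nabla U}$ is a fixed deterministic measurable function of $q$ (the output of an already trained neural network); it need not be the gradient of any function. One leapfrog step with the approximate gradient is the map $\Phi_\epsilon:(q,p)\mapsto(q',p')$ given by $$p^{1/2}=p-\tfrac{\epsilon}{2}\widehat{\nabla U}(q),\qquad q'=q+\epsilon\,p^{1/2},\qquad p'=p^{1/2}-\tfrac{\epsilon}{2}\widehat{\nabla U}(q').$$ The NNgHMC transition kernel from a state $(q,p)$ is as follows. (1) Replace $p$ by a fresh momentum $p_0\sim N(0,I_d)$ independent of everything else, and set $q_0=q$. (2) Compute $(q_L,p_L)=\Phi_\epsilon^{L}(q_0,p_0)$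 ($L$-fold composition) and form the proposal $(q^*,p^* )=(q_L,-p_L)$ (momentum negated). (3) With probability $\min\{1,\exp(H(q_0,p_0)-H(q^*,p^* ))\}$ the new state is $(q^*,p^* )$; otherwise the new state is $(q_0,p_0)$. The true $H$, containing the exact $U$, is used in this Metropolis step. *)

(* Defs.v *)
From HB Require Import structures.
From mathcomp Require Import all_boot all_order all_algebra.
From mathcomp Require Import all_classical all_reals all_analysis.
From mathcomp Require Import measurable_realfun.

Set Implicit Arguments.
Unset Strict Implicit.
Unset Printing Implicit Defensive.

Import Order.TTheory GRing.Theory Num.Theory numFieldNormedType.Exports.

Local Open Scope classical_set_scope.
Local Open Scope ring_scope.

Section measurable_rV.
Context {R : realType}.
Variable n : nat.

Let coords : 'I_n -> 'rV[R]_n -> R := fun i v => v ord0 i.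

Let rV_set0 : g_sigma_preimage coords set0.
Proof. exact: sigma_algebra0. Qed.

Let rV_setC A : g_sigma_preimage coords A -> g_sigma_preimage coords (~` A).
Proof. exact: sigma_algebraC. Qed.

Let rV_bigcup (F : (set 'rV[R]_n)^nat) :
  (forall i, g_sigma_preimage coords (F i)) ->
  g_sigma_preimage coords (\bigcup_i (F i)).
Proof. exact: sigma_algebra_bigcup. Qed.

(* Row vectors carry the product sigma-algebra, generated by the coordinate
   maps; on R^n it is the Borel sigma-algebra. *)
HB.instance Definition _ := @isMeasurable.Build default_measure_display
  'rV[R]_n (g_sigma_preimage coords) rV_set0 rV_setC rV_bigcup.

Lemma measurable_coord (i : 'I_n) :
  measurable_fun [set: 'rV[R]_n] (fun v : 'rV[R]_n => v ord0 i : R).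
Proof.
move=> _ Y mY; rewrite setTI; apply: sub_sigma_algebra => /=.
rewrite -bigcup_seq/=; exists i => /=; first by rewrite mem_index_enum.
by exists Y => //; rewrite setTI.
Qed.

Lemma measurable_fun_rV d (T : measurableType d) (f : T -> 'rV[R]_n) :
  (forall i, measurable_fun [set: T] (fun x => f x ord0 i : R)) ->
  measurable_fun [set: T] f.
Proof.
move=> mf _ A mA; rewrite setTI.
suff : g_sigma_preimage coords `<=` [set B | measurable (f @^-1` B)] by apply.
apply: smallest_sub.
  split; rewrite /=.
  - by rewrite preimage_set0.
  - by move=> B mB; rewrite setTD preimage_setC; exact: measurableC.
  - by move=> F mF; rewrite preimage_bigcup; exact: bigcup_measurable.
rewrite -bigcup_seq => B [i _ [C mC <-]] /=; rewrite setTI.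
by rewrite -[X in measurable X]setTI; exact: mf.
Qed.

End measurable_rV.

Section power_measure.
Context {R : realType}.
Local Open Scope ereal_scope.

(* n-fold product of mu, carried to row vectors by (x, v) |-> (x, v_1 .. v_n) *)
Fixpoint power_measure (mu : set (measurableTypeR R) -> \bar R) (n : nat) :
    set 'rV[R]_n -> \bar R :=
  if n is n'.+1 then
    pushforward (mu \x @power_measure mu n')
      (fun z : measurableTypeR R * 'rV[R]_n' =>
         row_mx (z.1%:M : 'rV[R]_1) z.2 : 'rV[R]_n'.+1)
  else \d_(0%R : 'rV[R]_0).

Arguments power_measure : clear implicits.

Let cons_rV0 n (x : R) (v : 'rV[R]_n) :
  (row_mx (x%:M : 'rV[R]_1) v : 'rV[R]_n.+1) ord0 ord0 = x.
Proof.
rewrite (_ : ord0 = lshift n (ord0 : 'I_1)); last exact/val_inj.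
by apply/(etrans (row_mxEl _ v ord0 ord0)); rewrite mxE.
Qed.

Let cons_rVS n (x : R) (v : 'rV[R]_n) (i : 'I_n) :
  (row_mx (x%:M : 'rV[R]_1) v : 'rV[R]_n.+1) ord0 (lift ord0 i) = v ord0 i.
Proof.
rewrite (_ : lift ord0 i = rshift 1 i); last exact/val_inj.
exact: (row_mxEr (x%:M : 'rV[R]_1)).
Qed.

Lemma measurable_cons_rV n : measurable_fun setT
  (fun z : measurableTypeR R * 'rV[R]_n =>
     row_mx (z.1%:M : 'rV[R]_1) z.2 : 'rV[R]_n.+1).
Proof.
apply: measurable_fun_rV => i; have [j ->|->] := unliftP ord0 i.
  apply: (eq_measurable_fun ((fun v : 'rV[R]_n => v ord0 j : R) \o snd)).
    by move=> z _; rewrite /= cons_rVS.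
  exact: measurableT_comp (measurable_coord j) measurable_snd.
apply: (eq_measurable_fun fst); last exact: measurable_fst.
by move=> z _; rewrite cons_rV0.
Qed.

Section sigma_finite.
Variable mu : {sigma_finite_measure set (measurableTypeR R) -> \bar R}.

Lemma power_measure_subproof n :
  exists m : {sigma_finite_measure set 'rV[R]_n -> \bar R},
    m = power_measure mu n :> (set _ -> \bar R).
Proof.
elim: n => [|n [m mE]]; first by exists \d_(0%R : 'rV[R]_0).
pose p : {measure set 'rV[R]_n.+1 -> \bar R} :=
  measure_function_pushforward__canonical__measure_function_Measure
    (mu \x m) (@measurable_cons_rV n).
have psf : sigma_finite setT p.
  have /sigma_finiteP[F [TF ndF Foo]] := sigma_finiteT mu.
  have /sigma_finiteP[G [TG ndG Goo]] := sigma_finiteT m.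
  pose tl (v : 'rV[R]_n.+1) : 'rV[R]_n := rsubmx (v : 'rV[R]_(1 + n)).
  have mtl : measurable_fun setT tl.
    apply: measurable_fun_rV => i.
    apply: (eq_measurable_fun (fun v : 'rV[R]_n.+1 => v ord0 (rshift 1 i) : R)).
      by move=> v _; rewrite mxE.
    exact: measurable_coord.
  exists (fun k => [set v : 'rV[R]_n.+1 | F k (v ord0 ord0) /\ G k (tl v)]).
    rewrite predeqE => v; split => // _.
    have [a _ Fa] : (\bigcup_i F i) (v ord0 ord0) by rewrite -TF.
    have [b _ Gb] : (\bigcup_i G i) (tl v) by rewrite -TG.
    exists (maxn a b) => //; split.
    - by move: Fa; exact/subsetPset/ndF/leq_maxl.
    - by move: Gb; exact/subsetPset/ndG/leq_maxr.
  move=> k; have [mF Fk] := Foo k; have [mG Gk] := Goo k; split.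
    apply: measurableI.
      rewrite -[X in measurable X]setTI; exact: measurable_coord.
    rewrite -[X in measurable X]setTI; exact: mtl.
  rewrite [X in X < _](_ : _ = (mu \x m) (F k `*` G k)).
    by rewrite product_measure1E// lte_mul_pinfty// ge0_fin_numE.
  congr ((mu \x m) _); apply/seteqP.
  by split => -[x v] /=; rewrite cons_rV0 /tl row_mxKr.
pose ps := Measure_isSigmaFinite.Build _ _ _ p psf.
pose p' : {sigma_finite_measure set 'rV[R]_n.+1 -> \bar R} :=
  HB.pack (p : set _ -> \bar R) (Measure.class p) ps.
by exists p'; rewrite /= -mE.
Qed.

Let power_measure0 n : power_measure mu n set0 = 0.
Proof. by have [m <-] := power_measure_subproof n. Qed.

Let power_measure_ge0 n A : 0 <= power_measure mu n A.
Proof. by have [m <-] := power_measure_subproof n. Qed.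

Let power_measure_sigma_additive n :
  semi_sigma_additive (power_measure mu n).
Proof.
have [m <-] := power_measure_subproof n.
exact: measure_semi_sigma_additive.
Qed.

HB.instance Definition _ n := isMeasure.Build _ _ _ (power_measure mu n)
  (power_measure0 n) (@power_measure_ge0 n) (@power_measure_sigma_additive n).

Let power_measure_sigma_finite n : sigma_finite setT (power_measure mu n).
Proof. have [m <-] := power_measure_subproof n; exact: sigma_finiteT. Qed.

HB.instance Definition _ n := Measure_isSigmaFinite.Build _ _ _
  (power_measure mu n) (@power_measure_sigma_finite n).

Lemma power_measure_box n (A : 'I_n -> set (measurableTypeR R)) :
  (forall i, measurable (A i)) ->
  power_measure mu n [set v | forall i, A i (v ord0 i)] = \prod_(i < n) mu (A i).
Proof.
elim: n A => [|n IHn] A mA.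
  by rewrite big_ord0 /= diracE mem_set// => -[].
pose B := [set v : 'rV[R]_n | forall i, A (lift ord0 i) (v ord0 i)].
have mB : measurable B.
  rewrite (_ : B = \bigcap_i [set v : 'rV[R]_n | A (lift ord0 i) (v ord0 i)]).
    apply: fin_bigcap_measurable => // i _.
    rewrite -[X in measurable X]setTI.
    exact: measurable_coord (mA (lift ord0 i)).
  by apply/seteqP; split => v /= Av i => [_|]; exact: Av.
rewrite big_ord_recl -IHn// -product_measure1E//.
rewrite /= /pushforward; congr ((mu \x _) _); apply/seteqP; split => -[x v] /=.
  move=> Av; split; first by have := Av ord0; rewrite cons_rV0.
  by move=> i; have := Av (lift ord0 i); rewrite cons_rVS.
move=> [Ax Av] i; have [j ->|->] := unliftP ord0 i; first by rewrite cons_rVS.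
by rewrite cons_rV0.
Qed.

End sigma_finite.

Section probability.
Variable P : probability (measurableTypeR R) R.

Let power_measureT n : power_measure P n setT = 1.
Proof.
rewrite (_ : setT = [set v : 'rV[R]_n | forall i : 'I_n, setT (v ord0 i)]).
  rewrite (@power_measure_box P n (fun=> setT))//.
  by rewrite big1// => i _; exact: (probability_setT P).
by apply/seteqP.
Qed.

HB.instance Definition _ n := Measure_isProbability.Build _ _ _
  (power_measure P n) (@power_measureT n).

End probability.
End power_measure.
Arguments power_measure {R} mu n.

Definition lebesgue_rV (R : realType) (n : nat) : set 'rV[R]_n -> \bar R :=
  power_measure lebesgue_measure n.
Arguments lebesgue_rV {R} n.

HB.instance Definition _ (R : realType) n :=
  SigmaFiniteMeasure.on (@lebesgue_rV R n).

(* N(0, I_n): n independent standard normal coordinates *)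
Definition std_normal_rV (R : realType) (n : nat) : set 'rV[R]_n -> \bar R :=
  power_measure (normal_prob 0 1) n.
Arguments std_normal_rV {R} n.

HB.instance Definition _ (R : realType) n :=
  Probability.on (@std_normal_rV R n).

Section rV_measurability.
Context {R : realType} {n : nat} d (T : measurableType d).
Implicit Types f g : T -> 'rV[R]_n.

Let measurable_fun_coord f i : measurable_fun setT f ->
  measurable_fun setT (fun x => f x ord0 i : R).
Proof. by move=> mf; exact: measurableT_comp (measurable_coord i) mf. Qed.

Lemma measurable_funD_rV f g : measurable_fun setT f -> measurable_fun setT g ->
  measurable_fun setT (fun x => f x + g x).
Proof.
move=> mf mg; apply: measurable_fun_rV => i.
apply: (eq_measurable_fun (fun x => f x ord0 i + g x ord0 i)).
  by move=> x _; rewrite mxE.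
by apply: measurable_funD; exact: measurable_fun_coord.
Qed.

Lemma measurable_funZ_rV (c : R) f : measurable_fun setT f ->
  measurable_fun setT (fun x => c *: f x).
Proof.
move=> mf; apply: measurable_fun_rV => i.
apply: (eq_measurable_fun (fun x => c * f x ord0 i)).
  by move=> x _; rewrite mxE.
by apply: measurable_funM => //; exact: measurable_fun_coord.
Qed.

Lemma measurable_funN_rV f : measurable_fun setT f ->
  measurable_fun setT (fun x => - f x).
Proof.
move=> mf; under eq_fun do rewrite -scaleN1r.
exact: measurable_funZ_rV.
Qed.

Lemma measurable_fun_dot_rV f g :
  measurable_fun setT f -> measurable_fun setT g ->
  measurable_fun setT (fun x => (f x *m (g x)^T) ord0 ord0 : R).
Proof.
move=> mf mg.
apply: (eq_measurable_fun (fun x => \sum_(i < n) f x ord0 i * g x ord0 i)).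
  by move=> x _; rewrite mxE; apply: eq_bigr => i _; rewrite mxE.
apply: measurable_sum => i.
by apply: measurable_funM; exact: measurable_fun_coord.
Qed.

End rV_measurability.

Section NNgHMC.
Context {R : realType} {d : nat}.
Variables (U : {mfun 'rV[R]_d >-> R}) (g : {mfun 'rV[R]_d >-> 'rV[R]_d}).
Variables (eps : R) (L : nat).

Implicit Types z : 'rV[R]_d * 'rV[R]_d.

Definition hamiltonian z : R := U z.1 + 2^-1 * (z.2 *m z.2^T) ord0 ord0.

Lemma measurable_hamiltonian : measurable_fun setT hamiltonian.
Proof.
apply: measurable_funD.
  exact: measurableT_comp (measurable_funPT U) measurable_fst.
apply: measurable_funM => //.
exact: measurable_fun_dot_rV.
Qed.

Definition leapfrog z : 'rV[R]_d * 'rV[R]_d :=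
  let p_half := z.2 - (eps / 2) *: g z.1 in
  let q' := z.1 + eps *: p_half in
  (q', p_half - (eps / 2) *: g q').

Lemma measurable_leapfrog : measurable_fun setT leapfrog.
Proof.
have mB (f h : 'rV[R]_d * 'rV[R]_d -> 'rV[R]_d) : measurable_fun setT f ->
    measurable_fun setT h ->
    measurable_fun setT (fun z => f z - (eps / 2) *: g (h z)).
  move=> mf mh; apply: measurable_funD_rV => //.
  apply: measurable_funN_rV; apply: measurable_funZ_rV.
  exact: measurableT_comp (measurable_funPT g) mh.
have mq : measurable_fun setT (fun z => (leapfrog z).1).
  apply: measurable_funD_rV; first exact: measurable_fst.
  apply: measurable_funZ_rV.
  by apply: mB; [exact: measurable_snd|exact: measurable_fst].
apply: measurable_fun_pair => //.
by apply: (@mB) => //; apply: (@mB); [exact: measurable_snd|exact: measurable_fst].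
Qed.

Definition proposal z : 'rV[R]_d * 'rV[R]_d :=
  let z' := iter L leapfrog z in (z'.1, - z'.2).

Lemma measurable_proposal : measurable_fun setT proposal.
Proof.
have mi : measurable_fun setT (iter L leapfrog).
  elim: L => [|n IHn]; first exact: measurable_id.
  exact: measurableT_comp measurable_leapfrog IHn.
apply: measurable_fun_pair.
  exact: measurableT_comp measurable_fst mi.
by apply: measurable_funN_rV; exact: measurableT_comp measurable_snd mi.
Qed.

Definition acceptance z : R :=
  Num.min 1 (expR (hamiltonian z - hamiltonian (proposal z))).

Lemma measurable_acceptance : measurable_fun setT acceptance.
Proof.
apply: measurable_minr => //.
apply: measurableT_comp => //; apply: measurable_funB.
  exact: measurable_hamiltonian.
exact: measurableT_comp measurable_hamiltonian measurable_proposal.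
Qed.

Lemma acceptance_ge0 z : 0 <= acceptance z.
Proof. by rewrite le_min ler01 expR_ge0. Qed.

Lemma acceptance_le1 z : acceptance z <= 1.
Proof. by rewrite ge_min lexx. Qed.

Let rejection_ge0 z : 0 <= 1 - acceptance z.
Proof. by rewrite subr_ge0 acceptance_le1. Qed.

Local Open Scope ereal_scope.

Definition metropolis z : {measure set ('rV[R]_d * 'rV[R]_d) -> \bar R} :=
  measure_add
    (mscale (NngNum (acceptance_ge0 z)) \d_(proposal z))
    (mscale (NngNum (rejection_ge0 z)) \d_z).

Lemma metropolisE z A : metropolis z A =
  (acceptance z)%:E * \d_(proposal z) A + (1 - acceptance z)%:E * \d_z A.
Proof. exact: measure_addE. Qed.

Let measurable_metropolis A : measurable A ->
  measurable_fun setT (metropolis ^~ A).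
Proof.
move=> mA; under eq_fun do rewrite metropolisE.
have ma := measurable_acceptance.
apply: emeasurable_funD; apply: emeasurable_funM.
- exact/measurable_EFinP.
- exact: measurableT_comp (measurable_fun_dirac mA) measurable_proposal.
- by apply/measurable_EFinP; exact: measurable_funB.
- exact: measurable_fun_dirac.
Qed.

HB.instance Definition _ :=
  isKernel.Build _ _ _ _ _ metropolis measurable_metropolis.

Let metropolis_setT z : metropolis z setT = 1.
Proof. by rewrite metropolisE !diracT !mule1 -EFinD subrKC. Qed.

HB.instance Definition _ :=
  Kernel_isProbability.Build _ _ _ _ _ metropolis metropolis_setT.

Definition momentum_refresh z :
    {measure set ('rV[R]_d * 'rV[R]_d) -> \bar R} :=
  \d_(z.1) \x std_normal_rV d.

Lemma momentum_refreshE z A : measurable A ->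
  momentum_refresh z A = std_normal_rV d (xsection A z.1).
Proof.
move=> mA; rewrite /momentum_refresh /= /product_measure1 integral_dirac//=.
  by rewrite diracT mul1e.
exact: (measurable_fun_xsection (std_normal_rV d)).
Qed.

Let measurable_momentum_refresh A : measurable A ->
  measurable_fun setT (momentum_refresh ^~ A).
Proof.
move=> mA; under eq_fun do rewrite momentum_refreshE//.
exact: measurableT_comp (measurable_fun_xsection (std_normal_rV d) mA)
  measurable_fst.
Qed.

HB.instance Definition _ :=
  isKernel.Build _ _ _ _ _ momentum_refresh measurable_momentum_refresh.

Let momentum_refresh_setT z : momentum_refresh z setT = 1.
Proof.
rewrite momentum_refreshE// -[RHS](probability_setT (std_normal_rV d)).
by congr (std_normal_rV d _); apply/seteqP; split=> // p _; rewrite /xsection/= inE.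
Qed.

HB.instance Definition _ :=
  Kernel_isProbability.Build _ _ _ _ _ momentum_refresh momentum_refresh_setT.

Definition nnghmc :
    'rV[R]_d * 'rV[R]_d -> {measure set ('rV[R]_d * 'rV[R]_d) -> \bar R} :=
  mkcomp_noparam momentum_refresh metropolis.

Lemma nnghmcE z A : nnghmc z A =
  \int[\d_(z.1) \x std_normal_rV d]_w
    ((acceptance w)%:E * \d_(proposal w) A + (1 - acceptance w)%:E * \d_w A).
Proof. by apply: eq_integral => w _; exact: metropolisE. Qed.

HB.instance Definition _ := Kernel.on nnghmc.

Let nnghmc_setT z : nnghmc z setT = 1.
Proof.
rewrite /nnghmc /mkcomp_noparam /= /kcomp_noparam.
under eq_integral do rewrite metropolis_setT.
by rewrite integral_cst//= mul1e momentum_refresh_setT.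
Qed.

HB.instance Definition _ :=
  Kernel_isProbability.Build _ _ _ _ _ nnghmc nnghmc_setT.

End NNgHMC.

Section canonical_distribution.
Context {R : realType} {d : nat}.
Variable U : {mfun 'rV[R]_d >-> R}.
Local Open Scope ereal_scope.

Definition boltzmann (A : set ('rV[R]_d * 'rV[R]_d)) : \bar R :=
  \int[lebesgue_rV d \x lebesgue_rV d]_(z in A) (expR (- hamiltonian U z))%:E.

Let boltzmann0 : boltzmann set0 = 0.
Proof. exact: integral_set0. Qed.

Let boltzmann_ge0 A : 0 <= boltzmann A.
Proof. by apply: integral_ge0 => z _; rewrite lee_fin expR_ge0. Qed.

Let boltzmann_sigma_additive : semi_sigma_additive boltzmann.
Proof.
move=> F mF tF mUF; rewrite /boltzmann ge0_integral_bigcup//.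
- by apply: is_cvg_nneseries => n _ _; exact: boltzmann_ge0.
- apply: measurable_funTS; apply/measurable_EFinP.
  apply: measurableT_comp => //; apply: measurableT_comp => //.
  exact: measurable_hamiltonian.
Qed.

HB.instance Definition _ := isMeasure.Build _ _ _
  boltzmann boltzmann0 boltzmann_ge0 boltzmann_sigma_additive.

(* The default measure \d_point is used only when the total mass of
   exp (- H) is 0 or +oo. *)
Definition canonical_distribution : probability ('rV[R]_d * 'rV[R]_d)%type R :=
  mnormalize boltzmann \d_point.

End canonical_distribution.

Definition invariant_distribution d (T : measurableType d) (R : realType)
    (P : probability T R) (K : R.-pker T ~> T) : Prop :=
  forall A, measurable A -> (\int[P]_x K x A = P A)%E.

(* Main.v *)
(* Leapfrog is a composition of shears (q, p) |-> (q, p + a(q)) and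
   (q, p) |-> (q + b p, p). Shears preserve Lebesgue measure whether or not a is
   a gradient, and Phi followed by momentum negation is an involution. Hence
   the proposal T is a volume-preserving involution. As the acceptance ratio
   uses the exact H, the accepted flow min(exp(-H(z)), exp(-H(T z))) from z to
   T z is symmetric under T, so the Metropolis step is in detailed balance with
   exp(-H). Refreshing the momentum preserves exp(-H) because exp(-H) is the
   product of exp(-U) and an unnormalized standard Gaussian in p. *)
Require Import Defs.
From HB Require Import structures.
From mathcomp Require Import all_boot all_order all_algebra.
From mathcomp Require Import all_classical all_reals all_analysis.
From mathcomp Require Import measurable_realfun.
Import Order.TTheory GRing.Theory Num.Theory numFieldNormedType.Exports.
Local Open Scope classical_set_scope.
Local Open Scope ring_scope.

Set Implicit Arguments.
Unset Strict Implicit.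
Unset Printing Implicit Defensive.

(** * Measure-preserving maps and shears of product measures *)

Section measure_preserving.
Local Open Scope ereal_scope.

Definition measure_preserving d (T : measurableType d) (R : realType)
    (mu : set T -> \bar R) (phi : T -> T) : Prop :=
  measurable_fun setT phi /\
  forall A, measurable A -> mu (phi @^-1` A) = mu A.

Section theory.
Context d (T : measurableType d) (R : realType).
Variable mu : {measure set T -> \bar R}.

Lemma measure_preserving_id : measure_preserving mu id.
Proof. by split. Qed.

Lemma measure_preserving_comp (phi psi : T -> T) :
  measure_preserving mu phi -> measure_preserving mu psi ->
  measure_preserving mu (phi \o psi).
Proof.
move=> [mphi phiE] [mpsi psiE]; split; first exact: measurableT_comp.
move=> A mA; rewrite comp_preimage psiE ?phiE//.
by rewrite -[X in measurable X]setTI; exact: mphi.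
Qed.

Lemma measure_preserving_iter (phi : T -> T) n :
  measure_preserving mu phi -> measure_preserving mu (iter n phi).
Proof.
move=> mpphi; elim: n => [|n IHn]; first exact: measure_preserving_id.
exact: (measure_preserving_comp mpphi IHn).
Qed.

(** Change of variables: the pushforward of [mu] along [phi] agrees with [mu] on measurable sets,
    which determines integrals. *)
Lemma ge0_integral_measure_preserving (phi : T -> T) (f : T -> \bar R) :
  measure_preserving mu phi -> measurable_fun setT f -> (forall x, 0 <= f x) ->
  \int[mu]_x f (phi x) = \int[mu]_x f x.
Proof.
move=> [mphi phiE] mf f0.
rewrite -[LHS](@ge0_integral_pushforward _ _ _ _ _ phi mphi mu setT f)//.
by apply: eq_measure_integral => A mA _; exact: phiE.
Qed.

End theory.

Section product.
Context d1 d2 (T1 : measurableType d1) (T2 : measurableType d2) (R : realType).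
Variable m1 : {sigma_finite_measure set T1 -> \bar R}.
Variable m2 : {sigma_finite_measure set T2 -> \bar R}.

(** The section at [x] of the preimage of [A] is the preimage under [psi (x, _)] of the section of
    [A], and [\x] integrates the [m2]-measures of exactly these sections. *)
Lemma measure_preserving_shear2 (psi : T1 * T2 -> T2) :
  measurable_fun setT psi ->
  (forall x, measure_preserving m2 (fun y => psi (x, y))) ->
  measure_preserving (m1 \x m2) (fun z => (z.1, psi z)).
Proof.
move=> mpsi psiE; split; first exact: measurable_fun_pair.
move=> A mA; apply: eq_integral => x _ /=.
have [_ psixE] := psiE x.
by rewrite -[RHS]psixE//; exact: measurable_xsection.
Qed.

(** [\x] slices over the first factor, which this shear moves. The argument therefore passes to
    [\x^], which slices over the second factor and agrees with [\x] by uniqueness of product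
    measures. *)
Lemma measure_preserving_shear1 (psi : T1 * T2 -> T1) :
  measurable_fun setT psi ->
  (forall y, measure_preserving m1 (fun x => psi (x, y))) ->
  measure_preserving (m1 \x m2) (fun z => (psi z, z.2)).
Proof.
move=> mpsi psiE.
have mS : measurable_fun setT (fun z => (psi z, z.2)).
  exact: measurable_fun_pair.
have prodE A : measurable A -> (m1 \x m2) A = (m1 \x^ m2) A.
  by move=> mA; apply: product_measure_unique => //= B C mB mC;
    rewrite product_measure2E.
split=> // A mA.
rewrite !prodE//; last by rewrite -[X in measurable X]setTI; exact: mS.
apply: eq_integral => y _ /=.
have [_ psiyE] := psiE y.
by rewrite -[RHS]psiyE//; exact: measurable_ysection.
Qed.

End product.

End measure_preserving.

(** * Translations and reflection of the real line *)

Section lebesgue.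
Context {R : realType}.
Local Notation mu := (@lebesgue_measure R).

(** Lebesgue measure is determined by its values on half-open intervals, and the preimage of such an
    interval is its translate by [- u], of the same length. *)
Lemma measure_preserving_lebesgue_add (u : R) :
  measure_preserving mu
    (fun x : measurableTypeR R => x + u : measurableTypeR R).
Proof.
have mu_ : measurable_fun setT
    (fun x : measurableTypeR R => x + u : measurableTypeR R).
  exact: measurable_funD.
split=> // A mA; apply/esym.
apply: (@lebesgue_measure_unique R
  (measure_function_pushforward__canonical__measure_function_Measure
    mu mu_)) => // _ [[a b]] _ <-.
rewrite /= /pushforward (_ : _ @^-1` _ = `](a - u), (b - u)]%classic).
  rewrite !lebesgue_measure_itv/= !lte_fin ltrD2r -!EFinB.
  by rewrite opprB addrA subrK.
by apply/seteqP; split => x /=; rewrite !in_itv/= ltrBlDr lerBrDr.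
Qed.

Lemma measure_preserving_lebesgue_opp :
  measure_preserving mu (-%R : measurableTypeR R -> measurableTypeR R).
Proof. by split; [exact: oppr_measurable|exact: lebesgue_measureN]. Qed.

End lebesgue.

(** * Coordinatewise maps and iterated integrals for power measures *)

Section power_measure_theory.
Context {R : realType}.
Variable mu : {sigma_finite_measure set (measurableTypeR R) -> \bar R}.
Local Open Scope ereal_scope.

Lemma cons_rV0 n (x : R) (v : 'rV[R]_n) :
  (row_mx (x%:M : 'rV[R]_1) v : 'rV[R]_n.+1) ord0 ord0 = x.
Proof.
rewrite (_ : ord0 = lshift n (ord0 : 'I_1)); last exact/val_inj.
by apply/(etrans (row_mxEl _ v ord0 ord0)); rewrite mxE.
Qed.

Lemma cons_rVS n (x : R) (v : 'rV[R]_n) (i : 'I_n) :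
  (row_mx (x%:M : 'rV[R]_1) v : 'rV[R]_n.+1) ord0 (lift ord0 i) = v ord0 i.
Proof.
rewrite (_ : lift ord0 i = rshift 1 i); last exact/val_inj.
exact: (row_mxEr (x%:M : 'rV[R]_1)).
Qed.

(** Induction on the dimension: once a row vector is split into head and tail, the map is a shear
    changing only the tail followed by one changing only the head. *)
Lemma measure_preserving_power_measure n (phi : 'I_n -> R -> R) :
  (forall i, measure_preserving mu
    (phi i : measurableTypeR R -> measurableTypeR R)) ->
  measure_preserving (power_measure mu n)
    (fun v => \row_i phi i (v ord0 i)).
Proof.
have mrow m (psi : 'I_m -> R -> R) : (forall i, measure_preserving mu
    (psi i : measurableTypeR R -> measurableTypeR R)) ->
    measurable_fun setT (fun v : 'rV[R]_m => \row_i psi i (v ord0 i)).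
  move=> mppsi; apply: measurable_fun_rV => i.
  apply: (eq_measurable_fun (fun v : 'rV[R]_m => psi i (v ord0 i))).
    by move=> v _; rewrite mxE.
  by apply: measurableT_comp (measurable_coord i); have [] := mppsi i.
elim: n phi => [|n IHn] phi mpphi.
  split; first exact: mrow.
  move=> A mA; congr (_ _); rewrite (_ : (fun v => _) = id)//.
  by apply/funext => v; apply/rowP => -[].
split; first exact: mrow.
move=> A mA.
pose cons_rV (z : measurableTypeR R * 'rV[R]_n) : 'rV[R]_n.+1 :=
  row_mx (z.1%:M : 'rV[R]_1) z.2.
pose phi' i := phi (lift ord0 i).
have [mtl tlE] := IHn phi' (fun i => mpphi (lift ord0 i)).
have [mhd hdE] := mpphi ord0.
have : measure_preserving (mu \x power_measure mu n)
    ((fun z => (phi ord0 z.1 : measurableTypeR R, z.2)) \o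
     (fun z : measurableTypeR R * 'rV[R]_n =>
       (z.1, (\row_i phi' i (z.2 ord0 i) : 'rV[R]_n)))).
  apply: (@measure_preserving_comp _ _ _ (mu \x power_measure mu n)).
    by apply: measure_preserving_shear1 => //; exact: measurableT_comp.
  apply: (measure_preserving_shear2 mu (m2 := power_measure mu n)
    (psi := fun z : measurableTypeR R * 'rV[R]_n =>
      (\row_i phi' i (z.2 ord0 i) : 'rV[R]_n))) => //.
  exact: measurableT_comp mtl measurable_snd.
move=> [_ /(_ (cons_rV @^-1` A))].
rewrite /= /pushforward => <-.
  congr ((mu \x _) _); apply/funext => z.
  (* The coordinatewise map commutes with [cons_rV], so the two preimages of [A] coincide. *)
  have E : \row_i phi i (cons_rV z ord0 i) =
      cons_rV (phi ord0 z.1, \row_i phi' i (z.2 ord0 i)).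
    apply/rowP => i; rewrite mxE; have [j ->|->] := unliftP ord0 i.
      by rewrite /cons_rV !cons_rVS mxE.
    by rewrite /cons_rV !cons_rV0.
  exact: (congr1 A E).
by rewrite -[X in measurable X]setTI; exact: measurable_cons_rV.
Qed.

(** Tonelli for the product whose pushforward is the power measure; it peels off one coordinate in
    the induction for densities. *)
Lemma ge0_integral_power_measureS n (f : 'rV[R]_n.+1 -> \bar R) :
  measurable_fun setT f -> (forall v, 0 <= f v) ->
  \int[power_measure mu n.+1]_v f v =
  \int[mu]_x \int[power_measure mu n]_v f (row_mx (x%:M : 'rV[R]_1) v).
Proof.
move=> mf f0.
have mc := @measurable_cons_rV R n.
rewrite [LHS](ge0_integral_pushforward mc (mu \x power_measure mu n))//.
rewrite preimage_setT fubini_tonelli1//.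
  exact: measurableT_comp.
by move=> z; exact: f0.
Qed.

End power_measure_theory.

(** * Volume preservation and reversibility of the leapfrog map *)

Section leapfrog_theory.
Context {R : realType} {n : nat}.
Local Notation leb := (@lebesgue_rV R n).
Local Notation leb2 := (leb \x leb)%E.

Lemma measure_preserving_lebesgue_rV_add (u : 'rV[R]_n) :
  measure_preserving leb (fun v => v + u).
Proof.
rewrite (_ : (fun v => v + u) = fun v => \row_i (v ord0 i + u ord0 i)).
  apply: (measure_preserving_power_measure
    (phi := fun i x => x + u ord0 i)) => i.
  exact: measure_preserving_lebesgue_add.
by apply/funext => v; apply/rowP => i; rewrite !mxE.
Qed.

Lemma measure_preserving_lebesgue_rV_opp :
  measure_preserving leb (fun v => - v).
Proof.
rewrite (_ : (fun v : 'rV[R]_n => - v) = fun v => \row_i (- v ord0 i)).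
  apply: (measure_preserving_power_measure (phi := fun _ x => - x)) => i.
  exact: measure_preserving_lebesgue_opp.
by apply/funext => v; apply/rowP => i; rewrite !mxE.
Qed.

Variables (g : {mfun 'rV[R]_n >-> 'rV[R]_n}) (eps : R) (L : nat).
Implicit Types z : 'rV[R]_n * 'rV[R]_n.

Let kick z := (z.1, z.2 - (eps / 2) *: g z.1).

Let drift z := (z.1 + eps *: z.2, z.2).

Let flip z := (z.1, - z.2).

Let measure_preserving_kick : measure_preserving leb2 kick.
Proof.
apply: (measure_preserving_shear2 leb
  (psi := fun z => z.2 - (eps / 2) *: g z.1)).
  apply: measurable_funD_rV; first exact: measurable_snd.
  apply: measurable_funN_rV; apply: measurable_funZ_rV.
  exact: measurableT_comp (measurable_funPT g) measurable_fst.
move=> q; exact: (measure_preserving_lebesgue_rV_add (- ((eps / 2) *: g q))).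
Qed.

Let measure_preserving_drift : measure_preserving leb2 drift.
Proof.
apply: (measure_preserving_shear1 leb (psi := fun z => z.1 + eps *: z.2)).
  apply: measurable_funD_rV; first exact: measurable_fst.
  exact: measurable_funZ_rV measurable_snd.
move=> p; exact: (measure_preserving_lebesgue_rV_add (eps *: p)).
Qed.

Let measure_preserving_flip : measure_preserving leb2 flip.
Proof.
apply: (measure_preserving_shear2 leb (psi := fun z => - z.2)).
  exact: measurable_funN_rV measurable_snd.
by move=> q; exact: measure_preserving_lebesgue_rV_opp.
Qed.

(** [leapfrog] is convertible to [kick \o (drift \o kick)]. *)
Lemma measure_preserving_leapfrog :
  measure_preserving leb2 (leapfrog g eps).
Proof.
exact: (measure_preserving_comp measure_preserving_kick
  (measure_preserving_comp measure_preserving_drift measure_preserving_kick)).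
Qed.

Lemma measure_preserving_proposal :
  measure_preserving leb2 (proposal g eps L).
Proof.
exact: (measure_preserving_comp measure_preserving_flip
  (measure_preserving_iter L measure_preserving_leapfrog)).
Qed.

Lemma leapfrog_reversible z :
  leapfrog g eps (flip (leapfrog g eps z)) = flip z.
Proof.
case: z => q p; rewrite /leapfrog /flip /=.
set ph := p - (eps / 2) *: g q.
set q' := q + eps *: ph.
(* The first half kick of the return trip evaluates [g] at the same [q'] as the last one of the
   forward trip, so it undoes it. *)
have -> : - (ph - (eps / 2) *: g q') - (eps / 2) *: g q' = - ph.
  by rewrite opprB addrAC subrr add0r.
(* The drift is back at [q], so the remaining half kick undoes the initial one. *)
have -> : q' + eps *: - ph = q by rewrite scalerN /q' addrK.
by congr pair; rewrite /ph opprB addrAC subrr add0r.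
Qed.

(** Single-step reversibility cancels the last forward step against the first returning step,
    leaving [k] steps on each side of [flip]. *)
Lemma iter_leapfrog_reversible k z :
  iter k (leapfrog g eps) (flip (iter k (leapfrog g eps) z)) = flip z.
Proof.
elim: k z => [//|k IHk] z.
by rewrite iterSr iterS leapfrog_reversible IHk.
Qed.

Lemma proposalK : involutive (proposal g eps L).
Proof.
move=> z; transitivity (flip (flip z)).
  exact: (congr1 flip (iter_leapfrog_reversible L z)).
by case: z => q p; rewrite /flip /= opprK.
Qed.

End leapfrog_theory.

(** * Integration against measures given by a density *)

Section density.
Local Open Scope ereal_scope.
Context d (T : measurableType d) (R : realType).
Variables (mu nu : {measure set T -> \bar R}) (k : T -> R).
Hypothesis mk : measurable_fun setT k.
Hypothesis k0 : forall x, (0 <= k x)%R.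
Hypothesis nuE : forall A, measurable A -> nu A = \int[mu]_(x in A) (k x)%:E.

Import HBNNSimple.

(** A simple function is a finite sum of multiples of indicators of its level sets, and on each
    level set the claim is [nuE]. *)
Let integral_density_nnsfun (f : {nnsfun T >-> R}) :
  \int[nu]_x (f x)%:E = \int[mu]_x ((f x)%:E * (k x)%:E).
Proof.
have mEk : measurable_fun setT (EFin \o k) by exact/measurable_EFinP.
under eq_integral do rewrite fimfunE -fsumEFin//.
rewrite ge0_integral_fsum//; last 2 first.
- by move=> r; exact/measurable_EFinP/measurable_funM.
- by move=> r x _; rewrite nnfun_muleindic_ge0.
under [RHS]eq_integral => x _.
  rewrite fimfunE -fsumEFin// ge0_mule_fsuml; last first.
    by move=> r; rewrite EFinM nnfun_muleindic_ge0.
  over.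
rewrite ge0_integral_fsum//; last 2 first.
- move=> r; apply: emeasurable_funM => //.
  exact/measurable_EFinP/measurable_funM.
- move=> r x _; apply: mule_ge0; last by rewrite lee_fin.
  by rewrite EFinM nnfun_muleindic_ge0.
(* Writing [r] as the value [f y] makes it nonnegative, as needed to move it across the integral. *)
apply: eq_fsbigr => r; rewrite inE => -[y _ <-].
rewrite integralZl_indic_nnsfun// integral_indic// setIT nuE//.
rewrite integral_mkcond epatch_indic -ge0_integralZl//.
- apply: eq_integral => x _ /=; rewrite EFinM -muleA; congr (_ * _).
  exact: muleC.
- by apply: (emeasurable_funM mEk); exact/measurable_EFinP.
- by move=> x _; rewrite mule_ge0 ?lee_fin.
- by rewrite lee_fin.
Qed.

(** Monotone convergence on both sides along simple approximations of [f]; multiplying by [k], which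
    is nonnegative, keeps the sequence monotone. *)
Lemma ge0_integral_density (f : T -> \bar R) :
  measurable_fun setT f -> (forall x, 0 <= f x) ->
  \int[nu]_x f x = \int[mu]_x (f x * (k x)%:E).
Proof.
move=> mf f0; pose f_ := nnsfun_approx measurableT mf.
have f_cvg x : EFin \o f_ ^~ x @ \oo --> f x by exact: cvg_nnsfun_approx.
have mEk : measurable_fun setT (EFin \o k) by exact/measurable_EFinP.
have mf_ n : measurable_fun setT (EFin \o f_ n) by exact/measurable_EFinP.
transitivity (limn (fun n => \int[nu]_x (f_ n x)%:E)).
  rewrite -monotone_convergence//.
  - by apply: eq_integral => x _; apply/esym/cvg_lim => //; exact: f_cvg.
  - by move=> n x _; rewrite lee_fin.
  - by move=> x _ m n mn; rewrite lee_fin; exact/lefP/nd_nnsfun_approx.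
under eq_fun do rewrite integral_density_nnsfun.
rewrite -monotone_convergence//.
- apply: eq_integral => x _; apply/cvg_lim => //.
  by apply: cvgeZr => //; exact: f_cvg.
- by move=> n; exact: (emeasurable_funM (mf_ n) mEk).
- by move=> n x _; rewrite mule_ge0 ?lee_fin.
- move=> x _ m n mn; rewrite lee_wpmul2r ?lee_fin//.
  exact/lefP/nd_nnsfun_approx.
Qed.

End density.

(** Densities multiply over independent coordinates: by induction, the head contributes [k x]
    through the one-dimensional density formula and the tail contributes the remaining product. *)
Lemma ge0_integral_power_density (R : realType)
    (mu nu : {sigma_finite_measure set (measurableTypeR R) -> \bar R})
    (k : R -> R) (n : nat) (f : 'rV[R]_n -> \bar R) :
  measurable_fun setT (k : measurableTypeR R -> R) -> (forall x, 0 <= k x) ->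
  (forall A, measurable A -> nu A = \int[mu]_(x in A) (k x)%:E)%E ->
  measurable_fun setT f -> (forall v, (0 <= f v)%E) ->
  (\int[power_measure nu n]_v f v =
   \int[power_measure mu n]_v (f v * (\prod_(i < n) k (v ord0 i))%:E))%E.
Proof.
move=> mk k0 nuE; elim: n f => [|n IHn] f mf f0.
  by apply: eq_integral => v _; rewrite big_ord0 mule1.
have mc := @measurable_cons_rV R n.
have mprod m : measurable_fun setT
    (fun v : 'rV[R]_m => (\prod_(i < m) k (v ord0 i))%:E).
  apply/measurable_EFinP; apply: measurable_prod => i _.
  exact: measurableT_comp mk (measurable_coord i).
have prod0 m (v : 'rV[R]_m) : (0 <= (\prod_(i < m) k (v ord0 i))%:E)%E.
  by rewrite lee_fin prodr_ge0.
have mfc : measurable_fun setT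
    (fun z : measurableTypeR R * 'rV[R]_n =>
      f (row_mx (z.1%:M : 'rV[R]_1) z.2)).
  exact: measurableT_comp mf mc.
rewrite !ge0_integral_power_measureS//; last 2 first.
- exact: (emeasurable_funM mf (mprod n.+1)).
- by move=> v; rewrite mule_ge0.
rewrite (@ge0_integral_density _ _ _ mu nu k)//; last 2 first.
- exact: (measurable_fun_fubini_tonelli_F
    (fun z : measurableTypeR R * 'rV[R]_n =>
      f (row_mx (z.1%:M : 'rV[R]_1) z.2))).
- by move=> x; exact: integral_ge0.
apply: eq_integral => x _.
have mfx : measurable_fun setT
    (fun v : 'rV[R]_n => f (row_mx (x%:M : 'rV[R]_1) v)).
  exact: (measurableT_comp mfc (@pair1_measurable _ _ _ _ x)).
rewrite IHn// -ge0_integralZr//.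
- apply: eq_integral => v _; rewrite -muleA -EFinM big_ord_recl cons_rV0.
  rewrite mulrC; congr (_ * (_ * _)%:E)%E.
  by apply: eq_bigr => i _; rewrite cons_rVS.
- exact: (emeasurable_funM mfx (mprod n)).
- by move=> v _; rewrite mule_ge0.
- by rewrite lee_fin.
Qed.

(** * The standard normal law and its normalizing constant *)

Section gaussian.
Context {R : realType}.
Variable n : nat.

Local Notation leb := (@lebesgue_rV R n).
Local Notation c := (normal_peak (1 : R) ^+ n).

(** This is the momentum factor of exp(-H), kept unnormalized so that exp(-H) factors with no
    constant. *)
Definition gaussian_weight (p : 'rV[R]_n) : R :=
  expR (- (2^-1 * (p *m p^T) ord0 ord0)).

Lemma gaussian_weight_ge0 p : 0 <= gaussian_weight p.
Proof. exact: expR_ge0. Qed.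

Lemma measurable_gaussian_weight : measurable_fun setT gaussian_weight.
Proof.
apply: measurableT_comp => //; apply: measurableT_comp => //.
by apply: measurable_funM => //; exact: measurable_fun_dot_rV.
Qed.

Lemma prod_normal_pdf (p : 'rV[R]_n) :
  \prod_(i < n) normal_pdf 0 1 (p ord0 i) = c * gaussian_weight p.
Proof.
under eq_bigr do rewrite normal_pdfE ?oner_neq0//.
rewrite big_split/= prodr_const card_ord; congr (_ * _).
rewrite /normal_fun -expR_sum; congr expR.
rewrite mxE mulr_sumr -sumrN; apply: eq_bigr => i _.
by rewrite mxE subr0 expr1n -expr2 mulrC mulrN.
Qed.

Lemma ge0_integral_std_normal_rV (f : 'rV[R]_n -> \bar R) :
  measurable_fun setT f -> (forall v, (0 <= f v)%E) ->
  (\int[std_normal_rV n]_p f p =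
   c%:E * \int[leb]_p (f p * (gaussian_weight p)%:E))%E.
Proof.
move=> mf f0.
rewrite [LHS](@ge0_integral_power_density R lebesgue_measure
  (normal_prob 0 1) (normal_pdf 0 1))//; last 2 first.
- exact: measurable_normal_pdf.
- exact: normal_pdf_ge0.
have mw : measurable_fun setT (EFin \o gaussian_weight).
  by apply/measurable_EFinP; exact: measurable_gaussian_weight.
rewrite -ge0_integralZl//.
- apply: eq_integral => p _.
  by rewrite prod_normal_pdf EFinM muleCA.
- exact: (emeasurable_funM mf mw).
- by move=> p _; rewrite mule_ge0// lee_fin gaussian_weight_ge0.
- by rewrite lee_fin exprn_ge0// normal_peak_ge0.
Qed.

Lemma normal_peakX_neq0 : c != 0.
Proof. by rewrite expf_neq0// gt_eqF// normal_peak_gt0// oner_neq0. Qed.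

(** The value needs no Gaussian computation here: [std_normal_rV] has total mass 1, and its density
    is [c] times the weight. *)
Lemma integral_gaussian_weight :
  (\int[leb]_p (gaussian_weight p)%:E = c^-1%:E)%E.
Proof.
have N1 : (\int[@std_normal_rV R n]_p cst 1 p = 1)%E.
  rewrite integral_cst// mul1e.
  exact: (probability_setT (@std_normal_rV R n)).
move: N1; rewrite ge0_integral_std_normal_rV//.
under eq_integral do rewrite mul1e.
move=> E.
by rewrite -[RHS]mule1 -E muleA -EFinM mulVf ?normal_peakX_neq0// mul1e.
Qed.

End gaussian.

(** * Invariance of the Boltzmann measure under both stages of the kernel *)

Section invariance.
Context {R : realType} {d : nat}.
Variables (U : {mfun 'rV[R]_d >-> R}) (g : {mfun 'rV[R]_d >-> 'rV[R]_d}).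
Variables (eps : R) (L : nat).
Local Open Scope ereal_scope.

Local Notation leb := (@lebesgue_rV R d).
Local Notation H := (hamiltonian U).
Local Notation T := (proposal g eps L).
Local Notation c := (normal_peak (1 : R) ^+ d)%R.
Local Notation w := (@gaussian_weight R d).

Lemma expR_hamiltonian z : expR (- H z) = (expR (- U z.1) * w z.2)%R.
Proof. by rewrite /hamiltonian opprD expRD. Qed.

Let h z : \bar R := (expR (- H z))%:E.

Let mh : measurable_fun setT h.
Proof.
apply/measurable_EFinP; apply: measurableT_comp => //.
exact: measurableT_comp (measurable_hamiltonian U).
Qed.

Let h0 z : 0 <= h z. Proof. by rewrite lee_fin expR_ge0. Qed.

Let E (q : 'rV[R]_d) : \bar R := (expR (- U q))%:E.

Let mE : measurable_fun setT E.
Proof.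
apply/measurable_EFinP; apply: measurableT_comp => //.
exact: measurableT_comp (measurable_funPT U).
Qed.

Let E0 q : 0 <= E q. Proof. by rewrite lee_fin expR_ge0. Qed.

Let W (p : 'rV[R]_d) : \bar R := (w p)%:E.

Let mW : measurable_fun setT W.
Proof. by apply/measurable_EFinP; exact: measurable_gaussian_weight. Qed.

Let W0 p : 0 <= W p. Proof. by rewrite lee_fin gaussian_weight_ge0. Qed.

Let hE q p : h (q, p) = E q * W p.
Proof. by rewrite /h expR_hamiltonian EFinM. Qed.

Let cV0 : 0 <= (c^-1)%:E.
Proof. by rewrite lee_fin invr_ge0 exprn_ge0// normal_peak_ge0. Qed.

(** Integrating out the momentum reduces finiteness and positivity of the total mass to those of the
    integral of exp(-U). *)
Lemma boltzmann_setT :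
  boltzmann U setT = \int[leb]_q (expR (- U q))%:E * (c^-1)%:E.
Proof.
rewrite [LHS](fubini_tonelli1 h)// -(ge0_integralZr _ _ mE)//.
apply: eq_integral => q _; rewrite -integral_gaussian_weight -ge0_integralZl//.
  by apply: eq_integral => p _; exact: hE.
by move=> p _; exact: W0.
Qed.

(* The factors of H separate, and the refreshed momentum has density
   proportional to the momentum factor of exp (- H). *)
Lemma integral_momentum_refresh (f : 'rV[R]_d * 'rV[R]_d -> \bar R) :
  measurable_fun setT f -> (forall z, 0 <= f z) ->
  \int[leb \x leb]_z
    ((\int[std_normal_rV d]_p f (z.1, p)) * (expR (- H z))%:E) =
  \int[leb \x leb]_z (f z * (expR (- H z))%:E).
Proof.
move=> mf f0.
pose F q := \int[std_normal_rV d]_p f (q, p).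
have mF : measurable_fun setT F.
  exact: (measurable_fun_fubini_tonelli_F (m2 := std_normal_rV d) f).
have F0 q : 0 <= F q by exact: integral_ge0.
have mfq q : measurable_fun setT (fun p => f (q, p)).
  exact: (measurableT_comp mf (pair1_measurable q)).
rewrite [LHS]fubini_tonelli1; last 2 first.
- exact: (emeasurable_funM (measurableT_comp mF measurable_fst) mh).
- by move=> z; rewrite mule_ge0// F0.
rewrite [RHS]fubini_tonelli1; last 2 first.
- exact: (emeasurable_funM mf mh).
- by move=> z; rewrite mule_ge0.
apply: eq_integral => q _; rewrite /fubini_F/=.
(* Both sides equal this middle term. On the left [F q] is constant in [p], so the inner integral
   only sees the mass [c^-1] of the Gaussian weight. *)
transitivity (E q * F q * (c^-1)%:E).
  rewrite -integral_gaussian_weight -ge0_integralZl//; last 2 first.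
  - by move=> p _; exact: W0.
  - by rewrite mule_ge0.
  apply: eq_integral => p _.
  by rewrite [X in _ * X = _](hE q p) muleA [F q * _]muleC.
(* For the right side, the constant [c] of the normal density cancels [c^-1]. *)
rewrite [F q](ge0_integral_std_normal_rV (mfq q) (fun p => f0 (q, p))).
rewrite [_%:E * \int[_]_x _]muleC -!muleA.
rewrite -EFinM divff ?normal_peakX_neq0// mule1.
rewrite -ge0_integralZl//.
- by apply: eq_integral => p _; rewrite [X in _ = _ * X](hE q p) muleCA.
- exact: (emeasurable_funM (mfq q) mW).
- by move=> p _; exact: mule_ge0 (f0 _) (W0 p).
Qed.

(* The right-hand side is invariant under the involution T, which gives
   detailed balance. *)
Lemma acceptance_hamiltonian z :
  (acceptance U g eps L z * expR (- H z) =
   Num.min (expR (- H z)) (expR (- H (T z))))%R.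
Proof.
rewrite /acceptance minr_pMl ?expR_ge0// mul1r -expRD.
by rewrite addrAC subrr add0r.
Qed.

(** The weighted kernel splits into an accepted flow [m] landing at [T z] and a rejected remainder
    exp(-H) - [m] staying at [z]. Changing variables by [T] turns the accepted part into [m] on [A],
    and the two parts add up to exp(-H) on [A]. *)
Lemma integral_metropolis A : measurable A ->
  \int[leb \x leb]_z (metropolis U g eps L z A * (expR (- H z))%:E) =
  boltzmann U A.
Proof.
move=> mA.
have mT := measurable_proposal g eps L.
pose m z := Num.min (expR (- H z)) (expR (- H (T z))).
have mm : measurable_fun setT (EFin \o m).
  apply/measurable_EFinP; apply: measurable_minr; first exact/measurable_EFinP.
  by apply/measurable_EFinP; exact: measurableT_comp mh mT.
have m0 z : (0 <= m z)%R by rewrite le_min !expR_ge0.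
have hm0 z : (0 <= expR (- H z) - m z)%R by rewrite subr_ge0 ge_min lexx.
have mD (f : 'rV[R]_d * 'rV[R]_d -> 'rV[R]_d * 'rV[R]_d) :
    measurable_fun setT f ->
    measurable_fun setT (fun z => (\d_(f z) A : \bar R)).
  by move=> mf; exact: measurableT_comp (measurable_fun_dirac mA) mf.
have mTm z : m (T z) = m z by rewrite /m proposalK minC.
have mhm : measurable_fun setT (fun z => (expR (- H z) - m z)%:E).
  by apply/measurable_EFinP; apply: measurable_funB; exact/measurable_EFinP.
(* Writing [m (T z)] for [m z] makes the accepted term a function of [T z] alone, ready for the
   change of variables. *)
transitivity (\int[leb \x leb]_z ((m (T z))%:E * \d_(T z) A +
    (expR (- H z) - m z)%:E * \d_z A)).
  apply: eq_integral => z _; rewrite metropolisE ge0_muleDl; last 2 first.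
  - by rewrite mule_ge0// lee_fin acceptance_ge0.
  - by rewrite mule_ge0// lee_fin subr_ge0 acceptance_le1.
  have -> : (expR (- H z) - m z =
      (1 - acceptance U g eps L z) * expR (- H z))%R.
    by rewrite /m -acceptance_hamiltonian mulrBl mul1r.
  rewrite mTm /m -acceptance_hamiltonian !EFinM.
  by congr (_ + _); rewrite muleAC.
rewrite ge0_integralD//; last 4 first.
- by move=> z _; rewrite mule_ge0// lee_fin.
- exact: (emeasurable_funM (measurableT_comp mm mT) (mD _ mT)).
- by move=> z _; rewrite mule_ge0// lee_fin.
- exact: (emeasurable_funM mhm (mD _ (@measurable_id _ _ _))).
have mmA : measurable_fun setT (fun z => (m z)%:E * \d_z A).
  exact: (emeasurable_funM mm (mD _ (@measurable_id _ _ _))).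
rewrite (ge0_integral_measure_preserving (f := fun z => (m z)%:E * \d_z A)
  (measure_preserving_proposal g eps L))//; last first.
  by move=> z; rewrite mule_ge0// lee_fin.
rewrite -ge0_integralD//; last 3 first.
- by move=> z _; rewrite mule_ge0// lee_fin.
- by move=> z _; rewrite mule_ge0// lee_fin.
- exact: (emeasurable_funM mhm (mD _ (@measurable_id _ _ _))).
rewrite /boltzmann [RHS]integral_mkcond epatch_indic.
apply: eq_integral => z _.
by rewrite -ge0_muleDl ?lee_fin// -EFinD subrKC.
Qed.

(** Tonelli applies to the refreshed law, and its Dirac factor fixes the position at [z.1]. *)
Lemma nnghmc_fubini z A : measurable A ->
  nnghmc U g eps L z A =
  \int[std_normal_rV d]_p metropolis U g eps L (z.1, p) A.
Proof.
move=> mA.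
transitivity (\int[\d_(z.1) \x std_normal_rV d]_w metropolis U g eps L w A).
  by [].
have mM := measurable_kernel (metropolis U g eps L) A mA.
rewrite fubini_tonelli1//.
rewrite integral_dirac//; last first.
  exact: (measurable_fun_fubini_tonelli_F (m2 := std_normal_rV d)
    (fun z => metropolis U g eps L z A)).
by rewrite diracT mul1e.
Qed.

Lemma integral_boltzmann (f : 'rV[R]_d * 'rV[R]_d -> \bar R) :
  measurable_fun setT f -> (forall z, 0 <= f z) ->
  \int[boltzmann U]_z f z = \int[leb \x leb]_z (f z * (expR (- H z))%:E).
Proof.
move=> mf f0.
rewrite (@ge0_integral_density _ _ _ (leb \x leb) (boltzmann U)
  (fun z => expR (- H z)))//.
exact/measurable_EFinP.
Qed.

Lemma integral_boltzmann_nnghmc A : measurable A ->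
  \int[boltzmann U]_z nnghmc U g eps L z A = boltzmann U A.
Proof.
move=> mA; have mM := measurable_kernel (metropolis U g eps L) A mA.
rewrite integral_boltzmann//; last exact: measurable_kernel.
under eq_integral do rewrite nnghmc_fubini//.
rewrite (integral_momentum_refresh
  (f := fun z => metropolis U g eps L z A))//.
exact: integral_metropolis.
Qed.

End invariance.

Theorem theorem1 (R : realType) (d : nat)
  (U : {mfun 'rV[R]_d >-> R})
  (hU : (0 < \int[lebesgue_rV d]_q (expR (- U q))%:E < +oo)%E)
  (gradU_hat : {mfun 'rV[R]_d >-> 'rV[R]_d})
  (eps : R) (heps : 0 < eps) (L : nat) (hL : (1 <= L)%N) :
  invariant_distribution (canonical_distribution U) (nnghmc U gradU_hat eps L).
Proof.
move=> A mA.
have c0 : 0 < (normal_peak (1 : R) ^+ d)^-1.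
  by rewrite invr_gt0 exprn_gt0// normal_peak_gt0// oner_neq0.
(* This excludes the default branch of [mnormalize], so the canonical distribution is a genuine
   rescaling of [boltzmann U]. *)
have /andP[Z0 Zoo] : (0 < boltzmann U setT < +oo)%E.
  case/andP: hU => U0 Uoo; rewrite boltzmann_setT mule_gt0 ?lte_fin//=.
  by rewrite lte_mul_pinfty ?ltry ?lee_fin ?ltW// ge0_fin_numE// ltW.
have Zr0 : 0 <= (fine (boltzmann U setT))^-1 by rewrite invr_ge0 fine_ge0.
have canE B : canonical_distribution U B = mscale (NngNum Zr0) (boltzmann U) B.
  rewrite /canonical_distribution /= /mnormalize gt_eqF// lt_eqF//=.
  by rewrite /mscale /= muleC.
(* The scalar factors out of both sides, which leaves invariance of the unnormalized measure. *)
rewrite canE (eq_measure_integral (mscale (NngNum Zr0) (boltzmann U)))//.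
rewrite ge0_integral_mscale//; last exact: measurable_kernel.
  by rewrite integral_boltzmann_nnghmc.
by move=> B _ _; exact: canE.
Qed.
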